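(* (Strong maximum principle) Let $H=(V,E)$ be a connected finite hypergraph with vertex measure $\mu$ and hyperedge weight $\omega$. Let $\phi:V\to\mathbb{R}$ satisfy $\phi\ge0$ on $V$ and $-\Delta\phi(v)+c(v)\phi(v)\ge0$ for all $v\in V$, for some function $c:V\to\mathbb{R}$ with $c(v)\ge0$ for all $v\in V$. If there exists $v_0\in V$ such that $\phi(v_0)=0$, then $\phi\equiv0$ on $V$.
   Context: A (finite, undirected) hypergraph $H=(V,E)$ consists of a finite vertex set $V$ and a set $E$ of hyperedges, each hyperedge $e\in E$ being a subset of $V$ with cardinality $\delta_e:=|e|$ satisfying $2\le\delta_e\le|V|$. $H$ is connected if for any two different vertices $v,v'$ there is a sequence of hyperedges $e_1,\dots,e_l\in E$ with $v\in e_1$, $v'\in e_l$ and $e_n\cap e_{n+1}\ne\emptyset$ for $1\le n\le l-1$. The measure is a function $\mu:V\to(0,\infty)$ and the weight is a function $\omega:E\to(0,\infty)$, written $\omega_e=\omega(e)$. The Laplace operator (divergence of the hypergraph gradient) of $\phi:V\to\mathbb{R}$ is given explicitly by $$\Delta\phi(v)=\frac{1}{\mu(v)}\sum_{e\in E:\,v\in e}\frac{\omega_e}{\delta_e-1}\sum_{u\in e:\,u\ne v}(\phi(u)-\phi(v)),\quad v\in V.$$ *)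

(* Defs.v *)
From mathcomp Require Import all_boot all_order all_algebra.
From mathcomp Require Import reals.

Set Implicit Arguments.
Unset Strict Implicit.
Unset Printing Implicit Defensive.

Import Order.TTheory GRing.Theory Num.Theory.

Local Open Scope ring_scope.

Record hypergraph (V : finType) := Hypergraph {
  hyperedges : {set {set V}};
  hyperedge_card :
    forall e, e \in hyperedges -> (2 <= #|e| <= #|V|)%N
}.

(* The nonempty sequence e_1, ..., e_l is represented as e1 :: s. *)
Definition connected (V : finType) (H : hypergraph V) : Prop :=
  forall v v' : V, v != v' ->
    exists (e1 : {set V}) (s : seq {set V}),
      [/\ {subset e1 :: s <= hyperedges H},
          v \in e1,
          v' \in last e1 s
        & path (fun e f => e :&: f != set0) e1 s].

(* The weight omega is given on all subsets of V, but only its values on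
   hyperedges are used. *)
Definition laplacian (R : realType) (V : finType) (H : hypergraph V)
    (mu : V -> R) (omega : {set V} -> R) (phi : V -> R) (v : V) : R :=
  (mu v)^-1 *
  \sum_(e in hyperedges H | v \in e)
    omega e / (#|e|%:R - 1) * \sum_(u in e | u != v) (phi u - phi v).

(* Main.v *)
Require Import Defs.
From mathcomp Require Import all_boot all_order all_algebra.
From mathcomp Require Import reals.

(** At a zero [v] of [phi >= 0] the potential term [c v * phi v] vanishes, so
    the differential inequality says that the Laplacian of [phi] at [v] is
    nonpositive. But [v] is a minimum of [phi], so this Laplacian is also a
    sum of nonnegative terms with positive weights; hence every term vanishes
    and [phi] is zero on each hyperedge through [v]
    ([laplacian_le0_min_eq]). Thus zeros spread over whole hyperedges, and
    since consecutive hyperedges of a chain share a vertex, they spread along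
    chains ([path_hyperedge_closed]), which by connectedness reach every
    vertex. *)

Import Order.TTheory GRing.Theory Num.Theory.

Local Open Scope ring_scope.

(** The lower bound 2 on the size of a hyperedge makes [#|e| - 1] positive. *)
Lemma edge_coef_gt0 (R : realType) (V : finType) (H : hypergraph V)
    (omega : {set V} -> R) (e : {set V}) :
  e \in hyperedges H -> 0 < omega e -> 0 < omega e / (#|e|%:R - 1).
Proof.
move=> /hyperedge_card/andP[e_ge2 _] we_gt0.
by rewrite divr_gt0 // subr_gt0 ltr1n.
Qed.

(** The local form of the maximum principle: at a minimum the Laplacian is a
    positive combination of nonnegative differences [phi u - phi v], so it can
    be nonpositive only if all of them vanish. *)
Lemma laplacian_le0_min_eq (R : realType) (V : finType) (H : hypergraph V)
    (mu : V -> R) (omega : {set V} -> R) (phi : V -> R) (v : V) :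
  0 < mu v ->
  (forall e, e \in hyperedges H -> 0 < omega e) ->
  (forall u, phi v <= phi u) ->
  laplacian H mu omega phi v <= 0 ->
  forall e u, e \in hyperedges H -> v \in e -> u \in e -> phi u = phi v.
Proof.
move=> mu_gt0 w_gt0 v_min lap_le0 e u eH ve ue.
have [->//|u_neq_v] := eqVneq u v.
have diff_ge0 (f : {set V}) : 0 <= \sum_(x in f | x != v) (phi x - phi v).
  by apply: sumr_ge0 => x _; rewrite subr_ge0.
have term_ge0 (f : {set V}) : (f \in hyperedges H) && (v \in f) ->
    0 <= omega f / (#|f|%:R - 1) * \sum_(x in f | x != v) (phi x - phi v).
  by case/andP=> fH _; rewrite mulr_ge0 // ltW // (edge_coef_gt0 _ _ H) ?w_gt0.
have sum0 : \sum_(f in hyperedges H | v \in f)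
    omega f / (#|f|%:R - 1) * \sum_(x in f | x != v) (phi x - phi v) = 0.
  apply/eqP; rewrite eq_le sumr_ge0 // andbT.
  by move: lap_le0; rewrite /laplacian pmulr_rle0 // invr_gt0.
have /eqP := psumr_eq0P term_ge0 sum0 (introT andP (conj eH ve)).
rewrite mulf_eq0 gt_eqF ?(edge_coef_gt0 _ _ H) ?w_gt0 //= => /eqP e_sum0.
apply/eqP; rewrite -subr_eq0; apply/eqP.
apply: (psumr_eq0P _ e_sum0); last by rewrite ue.
by move=> x _; rewrite subr_ge0.
Qed.

(** A common vertex of two consecutive hyperedges carries the property from
    one to the next. *)
Lemma path_hyperedge_closed (V : finType) (H : hypergraph V) (P : V -> Prop) :
  (forall e u v, e \in hyperedges H -> v \in e -> u \in e -> P v -> P u) ->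
  forall (s : seq {set V}) (e1 : {set V}) (v u : V),
  {subset e1 :: s <= hyperedges H} ->
  path (fun e f => e :&: f != set0) e1 s ->
  v \in e1 -> u \in last e1 s -> P v -> P u.
Proof.
move=> P_closed; elim=> [|e2 s IHs] e1 v u sH /=.
  by move=> _; apply: P_closed; rewrite sH ?mem_head.
case/andP=> /set0Pn[w /setIP[we1 we2]] e2s ve1 us Pv.
apply: (IHs e2 w) => //; first by move=> f fs; rewrite sH // inE fs orbT.
by apply: (P_closed e1 w v); rewrite ?sH ?mem_head.
Qed.

Theorem lemma3p4 (R : realType) (V : finType) (H : hypergraph V)
    (mu : V -> R) (omega : {set V} -> R) (phi c : V -> R) (v0 : V)
    (Hconn : connected H)
    (mu_gt0 : forall v : V, 0 < mu v)
    (omega_gt0 : forall e : {set V}, e \in hyperedges H -> 0 < omega e)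
    (phi_ge0 : forall v : V, 0 <= phi v)
    (c_ge0 : forall v : V, 0 <= c v)
    (phi_super : forall v : V,
        0 <= - laplacian H mu omega phi v + c v * phi v)
    (phi_v0 : phi v0 = 0) :
  forall v : V, phi v = 0.
Proof.
move=> v; have [<-//|v0_neq_v] := eqVneq v0 v.
have [e1 [s [sH v0e1 vs e1s]]] := Hconn v0 v v0_neq_v.
have zero_spreads e x y : e \in hyperedges H -> y \in e -> x \in e ->
    phi y = 0 -> phi x = 0.
  move=> eH ye xe y0; rewrite -y0.
  apply: (laplacian_le0_min_eq _ _ H mu omega phi y) eH ye xe => //.
    by move=> z; rewrite y0.
  by have := phi_super y; rewrite y0 mulr0 addr0 oppr_ge0.
exact: (path_hyperedge_closed _ H _ zero_spreads s e1 v0 v).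
Qed.
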